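(* Let $k>1$, let $U_1\in\mathbb{F}_q^{k\times k}$, $U_2\in\mathbb{F}_q^{k\times(k+1)}$, $\mathbf{v}_1\in\mathbb{F}_q^k$, $\mathbf{v}_2\in\mathbb{F}_q^{k+1}$ be such that $(U_1\mid U_2)$ has rank $k$ and $V=(V_1\mid V_2)=\begin{pmatrix}U_1&U_2\\ \mathbf{v}_1&\mathbf{v}_2\end{pmatrix}$ has rank $k+1$, where $V_1=\begin{pmatrix}U_1\\ \mathbf{v}_1\end{pmatrix}$ and $V_2=\begin{pmatrix}U_2\\ \mathbf{v}_2\end{pmatrix}$. Let $\mathcal{F}=(\mathcal{F}_1,\dots,\mathcal{F}_{2k})$ be a full flag on $\mathbb{F}_q^{2k+1}$ with $\mathcal{F}_k=\mathrm{rowsp}(U_1\mid U_2)$ and $\mathcal{F}_{k+1}=\mathrm{rowsp}(V)$. The following are equivalent: (i) the flag code $\mathrm{Orb}_{\mathbf{G}}(\mathcal{F})$ is an optimum distance flag code; (ii) $U_1$ and $V_2$ are invertible matrices. In this situation, $|\mathrm{Orb}_{\mathbf{G}}(\mathcal{F})|=|\mathbf{G}|=q^{k+1}-1$.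
   Context: Let $M_{k+1}\in\mathrm{GL}(k+1,q)$ be the companion matrix of a primitive polynomial of degree $k+1$ over $\mathbb{F}_q$, let $g=\begin{pmatrix}I_k&0\\0&M_{k+1}\end{pmatrix}\in\mathrm{GL}(2k+1,q)$ and $\mathbf{G}=\langle g\rangle$. A full flag on $\mathbb{F}_q^{2k+1}$ is a chain $\mathcal{F}_1\subsetneq\cdots\subsetneq\mathcal{F}_{2k}$ of subspaces with $\dim\mathcal{F}_i=i$. $\mathrm{GL}(2k+1,q)$ acts on subspaces by $\mathcal{V}\cdot A=\mathrm{rowsp}(VA)$ and on flags componentwise. With $d_S(\mathcal{A},\mathcal{B})=\dim(\mathcal{A}+\mathcal{B})-\dim(\mathcal{A}\cap\mathcal{B})$ and $d_f(\mathcal{F},\mathcal{F}')=\sum_i d_S(\mathcal{F}_i,\mathcal{F}'_i)$, a flag code $\mathcal{C}$ of type $(t_1,\dots,t_r)$ on $\mathbb{F}_q^n$ is an optimum distance flag code if its minimum flag distance between distinct members ($0$ if $|\mathcal{C}|=1$) equals $2\left(\sum_{2t_i\leq n}t_i+\sum_{2t_i>n}(n-t_i)\right)$. *)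

(* Defs.v *)
From HB Require Import structures.
From mathcomp Require Import all_boot all_order all_algebra.
From mathcomp Require Import all_fingroup all_solvable all_field.

Set Implicit Arguments.
Unset Strict Implicit.
Unset Printing Implicit Defensive.

Import GRing.Theory.
Local Open Scope ring_scope.

(* The subspaces of a vector space over a finite field form a finite type, so
   that flag codes can be finite sets and orbits have a cardinal. *)
Section FiniteSubspaces.
Import VectorInternalTheory.
Variables (F : finFieldType) (vT : vectType F).

HB.instance Definition _ : Choice_isCountable {vspace vT} :=
  Choice_isCountable.Build _ (pcan_pickleK (can_pcan (@vs2mxK F vT))).
HB.instance Definition _ : isFinite {vspace vT} :=
  CanIsFinite (@vs2mxK F vT).

End FiniteSubspaces.

(* GLval u has dimension n.-1.+1, which is n whenever n > 0; the default value
   1%:M of the cast is only reached when n = 0, where it is the unique matrix. *)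
Definition glmx (F : finFieldType) (n : nat) (u : {'GL_n[F]}) : 'M[F]_n :=
  conform_mx 1%:M (GLval u).

Lemma glmx1 (F : finFieldType) (n : nat) : glmx (1%g : {'GL_n[F]}) = 1%:M.
Proof.
rewrite /glmx; case: n => [|m]; last by rewrite conform_mx_id.
by apply/matrixP; case.
Qed.

Lemma glmxM (F : finFieldType) (n : nat) (u v : {'GL_n[F]}) :
  glmx (u * v)%g = glmx u *m glmx v.
Proof.
case: n u v => [|m] u v; last by rewrite /glmx !conform_mx_id.
by apply/matrixP; case.
Qed.

Section Flags.
Variables (F : finFieldType) (n : nat).
Implicit Types (A B : {vspace 'rV[F]_n}) (u : {'GL_n[F]}).

Definition rowsp m (V : 'M[F]_(m, n)) : {vspace 'rV[F]_n} :=
  <<[seq row i V | i : 'I_m]>>%VS.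

Definition subspace_act A u : {vspace 'rV[F]_n} :=
  (linfun (mulmxr (glmx u)) @: A)%VS.

Lemma subspace_act_rowsp m (V : 'M[F]_(m, n)) u :
  subspace_act (rowsp V) u = rowsp (V *m glmx u).
Proof.
rewrite /subspace_act /rowsp limg_span -map_comp; congr (<<_>>)%VS.
by apply: eq_map => i; rewrite /= lfunE /= row_mul.
Qed.

Definition dS A B : nat := (\dim (A + B) - \dim (A :&: B))%N.

Section FlagsOfLength.
Variable r : nat.

(* The r subspaces are indexed by 'I_r, hence from 0. *)
Definition subspaces := {ffun 'I_r -> {vspace 'rV[F]_n}}.
Implicit Types (X Y : subspaces) (C : {set subspaces}) (t : 'I_r -> nat).

Definition is_flag t X : Prop :=
  [/\ forall i, (0 < t i < n)%N,
      forall i, \dim (X i) = t i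
    & forall i j : 'I_r, (i < j)%N -> (X i <= X j)%VS /\ X i <> X j].

Definition flag_act X u : subspaces := [ffun i => subspace_act (X i) u].

Lemma flag_act_is_action : is_action [set: {'GL_n[F]}] flag_act.
Proof.
have actM X u v : flag_act X (u * v)%g = flag_act (flag_act X u) v.
  apply/ffunP=> i; rewrite !ffunE /subspace_act -limg_comp.
  congr (_ @: _)%VS; apply/lfunP=> x.
  by rewrite comp_lfunE !lfunE /= glmxM mulmxA.
have act1 X : flag_act X 1%g = X.
  apply/ffunP=> i; rewrite ffunE /subspace_act -[RHS]lim1g.
  by congr (_ @: _)%VS; apply/lfunP=> x; rewrite !lfunE /= glmx1 mulmx1.
split=> [u X Y eqXY | X u v _ _]; last exact: actM.
by rewrite -[X]act1 -[Y]act1 -(mulgV u) !actM eqXY.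
Qed.

Canonical flag_action := Action flag_act_is_action.

Definition df X Y : nat := (\sum_(i < r) dS (X i) (Y i))%N.

Definition min_flag_dist C : nat :=
  let P (XY : subspaces * subspaces) :=
    [&& XY.1 \in C, XY.2 \in C & XY.1 != XY.2] in
  if [pick XY | P XY] is Some XY0 then
    let XY := [arg min_(XY < XY0 | P XY) df XY.1 XY.2]%N in df XY.1 XY.2
  else 0%N.

Definition is_flag_code t C : Prop :=
  C != set0 /\ forall X, X \in C -> is_flag t X.

Definition optimum_distance_flag_code t C : Prop :=
  is_flag_code t C /\
  min_flag_dist C = (2 * (\sum_(i < r | 2 * t i <= n) t i
                        + \sum_(i < r | n < 2 * t i) (n - t i)))%N.

End FlagsOfLength.
End Flags.

(* The type (1, 2, ..., r). *)
Definition full_type (r : nat) (i : 'I_r) : nat := i.+1.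

(* Main.v *)
Require Import Defs.
From HB Require Import structures.
From mathcomp Require Import all_boot all_order all_algebra.
From mathcomp Require Import all_fingroup all_solvable all_field.
From mathcomp Require Import zify.

Set Implicit Arguments.
Unset Strict Implicit.
Unset Printing Implicit Defensive.

Import GRing.Theory.
Local Open Scope ring_scope.

(* Since the minimal polynomial of M = M_(k+1) is primitive, the powers of M act
   transitively on nonzero row vectors; so M^i - M^j is zero or invertible and
   M has order q^(k+1) - 1.

   Two full flags X, Y are at maximal distance iff X_k and Y_k meet trivially
   and X_(k+1) + Y_(k+1) is the whole space. For X g^i and X g^j this says that
   (U1 U2 M^i; 0 U2 (M^j - M^i)) has rank 2k and (V1 V2 M^i; 0 V2 (M^j - M^i))
   has rank 2k+1, which is immediate when U1 and V2 are invertible.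

   Conversely, a single pair at maximal distance forces rank U2 = k and U1 <> 0,
   hence X has trivial stabilizer and both rank conditions hold for every
   M^i <> 1. If x U1 = 0 with w = x U2 nonzero, take u in rowsp U2 different
   from 0 and -w, which is possible because k > 1; some M^i maps u to u + w, so
   X_k and (X g^i)_k share a nonzero vector. The same construction applied to
   x V1 = 0, which always has a nonzero solution x, gives a common vector of
   X_(k+1) and (X g^i)_(k+1) besides those of the form (y V1 | 0) with
   y V2 = 0, so that no such y <> 0 can exist. *)

(** * Matrices with primitive characteristic polynomial *)

(** The indeterminate generates the nonzero residues modulo the characteristic polynomial, [plogp]
    is the discrete logarithm there, and Cayley-Hamilton carries the congruence over to [A]. *)
Lemma horner_mx_primitive_pow (F : finFieldType) (n : nat) (A : 'M[F]_n.+1)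
    (f : {poly F}) :
  (0 < n)%N -> primitive_poly (char_poly A) -> f != 0 -> (size f <= n.+1)%N ->
  exists i, horner_mx A f = A ^+ i.
Proof.
move=> n_gt0 prim f0 sf; exists (plogp (char_poly A) f).
have ndvd : ~~ (char_poly A %| f).
  by apply: contraL sf => /(dvdp_leq f0); rewrite size_char_poly -ltnNge.
have sp : (2 < size (char_poly A))%N by rewrite size_char_poly.
have /dvdpP[h eqf] := plogp_X sp prim ndvd.
move: (congr1 (horner_mx A) eqf).
rewrite rmorphM rmorphB rmorphXn /= horner_mx_X Cayley_Hamilton mulr0.
exact: subr0_eq.
Qed.

Lemma primitive_mx_unit (F : finFieldType) (n : nat) (A : 'M[F]_n.+1) :
  primitive_poly (char_poly A) -> A \in unitmx.
Proof.
move=> prim; have /primitive_polyP[_ dvd _] := prim; move: dvd.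
set N := _.-1 => /dvdpP[h eqN].
have N_gt0 : (0 < N)%N by rewrite ltn_predRL card_finNzRing_gt1.
have : A ^+ N = 1.
  move: (congr1 (horner_mx A) eqN).
  rewrite rmorphM rmorphB rmorphXn rmorph1 /= horner_mx_X Cayley_Hamilton mulr0.
  exact: subr0_eq.
by rewrite -(prednK N_gt0) exprS => /mulmx1_unit[].
Qed.

(** Vectors are read as polynomials of degree at most [n]. A nonzero one evaluates at [A] to a power
    of [A], which is invertible; so [ev] is injective, hence onto by finiteness. *)
Lemma primitive_mx_transitive (F : finFieldType) (n : nat) (A : 'M[F]_n.+1)
    (u w : 'rV[F]_n.+1) :
  (0 < n)%N -> primitive_poly (char_poly A) -> u != 0 -> w != 0 ->
  exists i, u *m A ^+ i = w.
Proof.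
move=> n_gt0 prim u0 w0.
have fromV (v : 'rV[F]_n.+1) : v != 0 ->
    exists i, horner_mx A (rVpoly v) = A ^+ i.
  move=> v0; apply: horner_mx_primitive_pow => //; last exact: size_poly.
  by apply: contra v0 => /eqP v0; rewrite -[v]rVpolyK v0 linear0.
pose ev (v : 'rV[F]_n.+1) := u *m horner_mx A (rVpoly v).
have ev_inj : injective ev.
  move=> v v' /eqP; rewrite -subr_eq0 -mulmxBr -rmorphB -linearB /= => ker.
  apply/eqP; rewrite -subr_eq0; apply: contraLR ker => /fromV[i ->].
  have /mulmxK uK : A ^+ i \in unitmx by apply/unitrX/primitive_mx_unit.
  by apply: contra u0 => /eqP ui0; rewrite -[u]uK ui0 mul0mx.
have /codomP[v wE] : w \in codom ev by rewrite injF_onto.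
have [|i vi] := fromV v; last by exists i; rewrite wE /ev vi.
by apply: contra w0 => /eqP v0; rewrite wE /ev v0 !linear0.
Qed.

(** All that the later arguments need to know about the companion matrix. *)
Definition pow_transitive (F : fieldType) (d : nat) (M : 'M[F]_d) :=
  forall u w : 'rV[F]_d, u != 0 -> w != 0 -> exists i, u *m M ^+ i = w.

Lemma companionmx_transitive (F : finFieldType) (p : {poly F}) (d : nat)
    (dE : (size p).-1 = d) :
  (1 < d)%N -> primitive_poly p ->
  pow_transitive (castmx (dE, dE) (companionmx p)).
Proof.
case: d / dE => d_gt1 prim; rewrite castmx_id.
have : char_poly (companionmx p) = p.
  by apply: companionmxK; case/and4P: prim.
move: (companionmx p); case: (_.-1) d_gt1 => [//|n] n_gt0 A pA u w.
by apply: primitive_mx_transitive; rewrite ?pA.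
Qed.

Lemma delta_row_neq0 (F : fieldType) d (j : 'I_d) :
  delta_mx 0 j != 0 :> 'rV[F]_d.
Proof.
by apply/eqP=> /matrixP/(_ 0 j)/eqP; rewrite !mxE !eqxx oner_eq0.
Qed.

Lemma nonunitmx_ker (F : fieldType) m (B : 'M[F]_m) :
  B \notin unitmx -> exists2 x : 'rV[F]_m, x != 0 & x *m B = 0.
Proof.
rewrite -row_free_unit -kermx_eq0 => /rowV0Pn[x /sub_kermxP xB x0].
by exists x.
Qed.

Section PowTransitive.
Variables (F : fieldType) (d : nat) (M : 'M[F]_d).
Hypothesis trM : pow_transitive M.

(** Powers of [M] commute, so agreement at one nonzero vector spreads along its orbit, which
    contains every basis vector. *)
Lemma pow_transitive_eq (u : 'rV[F]_d) i j :
  u != 0 -> u *m M ^+ i = u *m M ^+ j -> M ^+ i = M ^+ j.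
Proof.
move=> u0 eq_u; apply/row_matrixP=> l; rewrite !rowE.
have [s <-] := trM u0 (delta_row_neq0 F l); rewrite -!mulmxA.
have comm a b : M ^+ a *m M ^+ b = M ^+ b *m M ^+ a.
  by apply: commrX; apply/commr_sym/commrX.
by rewrite !(comm s) !mulmxA eq_u.
Qed.

Lemma pow_sub_unit i j : M ^+ i != M ^+ j -> M ^+ i - M ^+ j \in unitmx.
Proof.
apply: contraNT => /nonunitmx_ker[u u0 /eqP].
by rewrite mulmxBr subr_eq0 => /eqP/(pow_transitive_eq u0)->.
Qed.

End PowTransitive.

(** * Row spaces and matrix ranks *)

Section RowSpaces.
Variables (F : finFieldType) (n : nat).

Lemma mem_rowsp m (V : 'M[F]_(m, n)) (x : 'rV_n) :
  (x \in rowsp V) = (x <= V)%MS.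
Proof.
apply/idP/submxP => [|[D ->]].
  suff /subvP sVf : (rowsp V <= linfun (mulmxr V) @: fullv)%VS.
    by case/sVf/memv_imgP=> D _ ->; exists D; rewrite lfunE.
  apply/span_subvP=> _ /mapP[i _ ->]; rewrite rowE.
  by apply/memv_imgP; exists (delta_mx 0 i); rewrite ?memvf ?lfunE.
rewrite mulmx_sum_row; apply: rpred_sum => i _; apply: rpredZ.
by apply/memv_span/map_f; rewrite mem_enum.
Qed.

Lemma rowspS m1 m2 (V : 'M[F]_(m1, n)) (W : 'M[F]_(m2, n)) :
  (rowsp V <= rowsp W)%VS = (V <= W)%MS.
Proof.
apply/subvP/row_subP => sVW.
  by move=> i; rewrite -mem_rowsp sVW // mem_rowsp row_sub.
move=> x; rewrite !mem_rowsp => /submx_trans; apply; exact/row_subP.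
Qed.

Lemma dim_rowsp m (V : 'M[F]_(m, n)) : \dim (rowsp V) = \rank V.
Proof.
(* Coordinates relative to [row_base V] parametrize the row space injectively. *)
have -> : rowsp V = (linfun (mulmxr (row_base V)) @: fullv)%VS.
  apply/vspaceP=> x; rewrite mem_rowsp -(eq_row_base V).
  apply/submxP/memv_imgP => [[D ->]|[D _ ->]]; exists D;
    by rewrite ?memvf ?lfunE.
rewrite limg_dim_eq ?dimvf /dim /= ?mul1n //.
apply/eqP; rewrite -subv0; apply/subvP=> x; rewrite memv_cap memv_ker lfunE /=.
case/andP=> _ /eqP x0; rewrite memv0; apply/eqP.
by apply: (row_free_inj (row_base_free V)); rewrite mul0mx.
Qed.

Lemma rowsp_add m1 m2 (V : 'M[F]_(m1, n)) (W : 'M[F]_(m2, n)) :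
  (rowsp V + rowsp W)%VS = rowsp (col_mx V W).
Proof.
apply/eqP; rewrite eqEsubv subv_add !rowspS -col_mx_sub submx_refl /=.
apply/subvP=> x; rewrite mem_rowsp -addsmxE => /sub_addsmxP[[D1 D2] /= ->].
by apply: memv_add; rewrite mem_rowsp submxMl.
Qed.

End RowSpaces.

(** * Maximal distances of subspaces and of flags *)

Section SubspaceDistance.
Variables (F : finFieldType) (n : nat).
Implicit Types A B : {vspace 'rV[F]_n}.

Lemma dS_max A B t :
  \dim A = t -> \dim B = t -> (dS A B <= 2 * minn t (n - t))%N.
Proof.
move=> dA dB; have := dimv_sum_cap A B; rewrite dA dB /dS.
have := dimvS (capvSl A B); rewrite dA.
have := dimvS (subvf (A + B)%VS); rewrite dimvf /dim /= mul1n; lia.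
Qed.

(** By the dimension formula [dS A B] is twice [\dim (A + B)] minus [2 * t]. The sum is preferred to
    the intersection because its dimension is the rank of a stacked matrix. *)
Lemma dS_eq_max_low A B t : (2 * t <= n)%N -> \dim A = t -> \dim B = t ->
  (dS A B = (2 * minn t (n - t))%N) <-> (\dim (A + B) = (2 * t)%N).
Proof.
by move=> tn dA dB; have := dimv_sum_cap A B; rewrite dA dB /dS; lia.
Qed.

Lemma dS_eq_max_high A B t :
  (n <= 2 * t)%N -> (t <= n)%N -> \dim A = t -> \dim B = t ->
  (dS A B = (2 * minn t (n - t))%N) <-> (\dim (A + B) = n).
Proof.
move=> nt tn dA dB; have := dimvS (addvSl A B); rewrite dA; 
have := dimv_sum_cap A B; rewrite dA dB /dS; lia.
Qed.

End SubspaceDistance.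

Section OptimumDistance.
Variables (F : finFieldType) (n r : nat) (t : 'I_r -> nat).
Implicit Types (Y Z : subspaces F n r) (C : {set subspaces F n r}).

Lemma max_flag_distE :
  (2 * (\sum_(i < r | 2 * t i <= n) t i + \sum_(i < r | n < 2 * t i) (n - t i))
     = \sum_(i < r) 2 * minn (t i) (n - t i))%N.
Proof.
rewrite -big_distrr /=; congr (2 * _)%N.
rewrite [RHS](bigID (fun i => 2 * t i <= n)%N) /=; congr addn.
  by apply: eq_bigr => i ?; lia.
by apply: eq_big => i *; [rewrite ltnNge | lia].
Qed.

(** The bound is a sum of bounds on the components, so it is attained only if each of them is. Its
    positivity excludes codes without two distinct members, whose distance is 0 by default. *)
Lemma optimum_distanceP C :
  (0 < \sum_(i < r) minn (t i) (n - t i))%N -> is_flag_code t C ->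
  optimum_distance_flag_code t C <->
    (exists Y Z, [/\ Y \in C, Z \in C & Y != Z]) /\
    (forall Y Z i, Y \in C -> Z \in C -> Y != Z ->
       dS (Y i) (Z i) = (2 * minn (t i) (n - t i))%N).
Proof.
move=> max_gt0 flagC; rewrite /optimum_distance_flag_code max_flag_distE.
set D := (\sum_(i < r) _)%N.
have D_gt0 : (0 < D)%N by rewrite /D -big_distrr muln_gt0.
have dS_le Y Z i : Y \in C -> Z \in C ->
    (dS (Y i) (Z i) <= 2 * minn (t i) (n - t i))%N.
  by case: flagC => _ fl /fl[_ dY _] /fl[_ dZ _]; apply: dS_max.
rewrite /min_flag_dist; case: pickP => [[Y0 Z0] /= P0|no_pair]; last first.
  split=> [[_ D0]|[[Y [Z [YC ZC YZ]]] _]]; first by rewrite -D0 in D_gt0.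
  by have := no_pair (Y, Z); rewrite /= YC ZC YZ.
case: arg_minnP => [//|[Y1 Z1] /= /and3P[Y1C Z1C YZ1] min_df].
split=> [[_ dfD]|[_ dSD]].
  split=> [|Y Z i YC ZC YZ]; first by exists Y1, Z1.
  have df_ge : (D <= df Y Z)%N.
    by rewrite -dfD; apply: (min_df (Y, Z)); rewrite /= YC ZC.
  apply/eqP; rewrite eqn_leq dS_le //= leqNgt; apply/negP => lt_i.
  have : (df Y Z < D)%N.
    rewrite /df /D (bigD1 i) //= [ltnRHS](bigD1 i) //= -addSn.
    by apply: leq_add => //; apply: leq_sum => j _; apply: dS_le.
  by rewrite ltnNge df_ge.
by split=> //; apply: eq_bigr => i _; apply: dSD.
Qed.

End OptimumDistance.

(** * The linear group acting on flags *)

Section FlagAction.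
Variables (F : finFieldType) (n r : nat).

Lemma glmx_unit (u : {'GL_n[F]}) : glmx u \in unitmx.
Proof.
have : glmx u *m glmx u^-1%g = 1%:M by rewrite -glmxM mulgV glmx1.
by case/mulmx1_unit.
Qed.

(** For [n = 0] the group type is a copy of GL_1, on which [glmx] is constant. *)
Lemma glmx_inj : (0 < n)%N -> injective (@glmx F n).
Proof.
by case: n => // m _ u v; rewrite /glmx !conform_mx_id => eq_uv; apply: val_inj.
Qed.

Lemma lker_subspace_act (u : {'GL_n[F]}) :
  lker (linfun (mulmxr (glmx u)) : 'End('rV[F]_n)) == 0%VS.
Proof.
apply/lker0P=> x y; rewrite !lfunE /=.
by move/(congr1 (mulmx^~ (invmx (glmx u)))); rewrite !mulmxK ?glmx_unit.
Qed.

Lemma flag_act_is_flag t (X : subspaces F n r) (u : {'GL_n[F]}) :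
  is_flag t X -> is_flag t (flag_act X u).
Proof.
case=> t_bd dX nestX; split=> // i; rewrite ?ffunE.
  by rewrite limg_dim_eq // (eqP (lker_subspace_act u)) capv0.
move=> j lt_ij; have [sXij neqX] := nestX i j lt_ij.
rewrite !ffunE; split; first exact: limgS.
move=> /eqP; rewrite eqEsubv !limg_ker0 ?lker_subspace_act // -eqEsubv.
by move/eqP.
Qed.

End FlagAction.

(** * Ranks of block matrices *)

Section BlockRank.
Variable F : fieldType.

(** Subtracting the upper block row from the lower one is invertible, and cancels the part [P] that
    [g] fixes. *)
Lemma rank_col_row_mx m c d (P : 'M[F]_(m, c)) (R S : 'M_(m, d)) :
  \rank (col_mx (row_mx P R) (row_mx P S)) =
  \rank (block_mx P R 0 (S - R)).
Proof.
have -> : block_mx P R 0 (S - R) =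
    block_mx 1%:M 0 (- 1%:M) 1%:M *m col_mx (row_mx P R) (row_mx P S).
  rewrite mul_block_col !mul1mx mul0mx addr0 mulNmx mul1mx.
  by rewrite opp_row_mx add_row_mx addNr [- R + S]addrC.
rewrite eqmxMfull // row_full_unit unitmxE det_lblock !det1 mulr1.
exact: unitr1.
Qed.

(** The invertible [P] clears [R] by column operations; in the next lemma [S] does so by row
    operations. *)
Lemma rank_ublock_unitl m m' d (P : 'M[F]_m) (R : 'M_(m, d)) (S : 'M_(m', d)) :
  P \in unitmx -> \rank (block_mx P R 0 S) = (m + \rank S)%N.
Proof.
move=> P_unit; have -> : block_mx P R 0 S =
    block_mx P 0 0 S *m block_mx 1%:M (invmx P *m R) 0 1%:M.
  by rewrite mulmx_block !mulmx1 !mulmx0 !mul0mx !addr0 !add0r mulKVmx.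
rewrite mxrankMfree ?rank_diag_block_mx ?mxrank_unit //.
by rewrite row_free_unit unitmxE det_ublock !det1 mulr1 unitr1.
Qed.

Lemma rank_ublock_unitr m c d (P : 'M[F]_(m, c)) (R : 'M_(m, d)) (S : 'M_d) :
  S \in unitmx -> \rank (block_mx P R 0 S) = (\rank P + d)%N.
Proof.
move=> S_unit; have -> : block_mx P R 0 S =
    block_mx 1%:M (R *m invmx S) 0 1%:M *m block_mx P 0 0 S.
  by rewrite mulmx_block !mul1mx !mulmx0 !mul0mx !addr0 !add0r mulmxKV.
rewrite eqmxMfull ?rank_diag_block_mx ?mxrank_unit //.
by rewrite row_full_unit unitmxE det_ublock !det1 mulr1 unitr1.
Qed.

(* If [A] mapped the row space of [(P | Q)] to itself, the latter would contain
   [(0 | Q (A - 1))], hence equal it. *)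
Lemma row_mx_stab_eq0 m c d (P : 'M[F]_(m, c)) (Q : 'M_(m, d)) (A : 'M_d) :
  row_free Q -> A - 1%:M \in unitmx ->
  (row_mx P (Q *m A) <= row_mx P Q)%MS -> P = 0.
Proof.
move=> Qfree Aunit stabPQ; pose W := row_mx (0 : 'M_(m, c)) (Q *m (A - 1%:M)).
have sW : (W <= row_mx P Q)%MS.
  have -> : W = row_mx P (Q *m A) - row_mx P Q.
    by rewrite opp_row_mx add_row_mx subrr /W mulmxBr mulmx1.
  by rewrite addmx_sub // eqmx_opp.
have /eqP rW : row_free W.
  apply: inj_row_free => v; rewrite mul_mx_row => /eqP.
  rewrite row_mx_eq0 mulmxA => /andP[_ /eqP vQA].
  apply: (row_free_inj Qfree); rewrite mul0mx -[v *m Q](mulmxK Aunit) vQA.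
  by rewrite mul0mx.
have : (row_mx P Q <= W)%MS.
  by rewrite -(geq_leqif (mxrank_leqif_sup sW)) rW rank_leq_row.
by case/submxP=> D; rewrite mul_mx_row mulmx0 => /eq_row_mx[].
Qed.

(** Two basis vectors have distinct nonzero images, and at most one of these is [w]. *)
Lemma row_free_avoid m d (Q : 'M[F]_(m, d)) (w : 'rV_d) :
  (1 < m)%N -> row_free Q -> exists b : 'rV_m, b *m Q != 0 /\ b *m Q != w.
Proof.
case: m Q => [|[|m]] // Q _ Qfree; have injQ := @row_free_inj _ 1 _ _ Q Qfree.
pose e (j : 'I_m.+2) : 'rV[F]_m.+2 := delta_mx 0 j.
have e_neq0 j : e j *m Q != 0.
  by rewrite -(mul0mx 1 Q) (inj_eq injQ) delta_row_neq0.
have [e0w|] := eqVneq (e 0 *m Q) w; last by exists (e 0).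
exists (e 1); split=> //; rewrite -e0w (inj_eq injQ).
by apply/eqP=> /matrixP/(_ 0 1)/eqP; rewrite !mxE /= oner_eq0.
Qed.

End BlockRank.

(** * Common vectors of a row space and its translates *)

Section TransitiveIntersections.
Variables (F : fieldType) (d : nat) (M : 'M[F]_d).
Hypothesis trM : pow_transitive M.

(** Some [M ^+ i] maps [b *m Q] to [(b + x) *m Q]. As [x] kills [P], the combination [b + x] of the
    rows of [(P | Q)] is then the combination [b] of the translated rows. *)
Lemma translate_ker m c (P : 'M[F]_(m, c)) (Q : 'M_(m, d)) (x b : 'rV_m) :
  x *m P = 0 -> x *m Q != 0 -> b *m Q != 0 -> b *m Q != - (x *m Q) ->
  exists i, M ^+ i != 1 /\
    row_mx (b + x) (- b) *m
      col_mx (row_mx P Q) (row_mx P (Q *m M ^+ i)) = 0.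
Proof.
move=> xP xQ bQ bxQ; have bxQ0 : (b + x) *m Q != 0.
  by rewrite mulmxDl addr_eq0.
have [i bQi] := trM bQ bxQ0; exists i; split.
  apply: contra xQ => /eqP Mi1; move: bQi; rewrite Mi1 mulmx1 mulmxDl.
  by move/eqP; rewrite -subr_eq0 opprD addNKr oppr_eq0.
rewrite mul_row_col !mul_mx_row add_row_mx !mulNmx mulmxDl xP addr0 subrr.
by rewrite mulmxA bQi subrr row_mx0.
Qed.

Lemma trivial_cap_unit k (P : 'M[F]_k) (Q : 'M_(k, d)) :
  (1 < k)%N -> row_free (row_mx P Q) -> row_free Q ->
  (forall i, M ^+ i != 1 ->
     row_free (col_mx (row_mx P Q) (row_mx P (Q *m M ^+ i)))) ->
  P \in unitmx.
Proof.
move=> k_gt1 PQfree Qfree capP; apply/negPn/negP=> /nonunitmx_ker[x x0 xP].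
have xQ : x *m Q != 0.
  by rewrite -(mul0mx 1 Q) (inj_eq (@row_free_inj _ 1 _ _ _ Qfree)).
have [b [bQ bxQ]] := row_free_avoid (- (x *m Q)) k_gt1 Qfree.
have [i [Mi ker]] := translate_ker xP xQ bQ bxQ.
have /eqP : row_mx (b + x) (- b) = 0.
  by apply: (row_free_inj (capP i Mi)); rewrite ker mul0mx.
rewrite row_mx_eq0 oppr_eq0 => /andP[_ /eqP b0].
by rewrite b0 mul0mx eqxx in bQ.
Qed.

(** The rank hypothesis allows the stacked matrix a left kernel of dimension at most 1. A [y]
    killing [Q] puts [(y | -y)] into it for every [i], and [translate_ker] adds an independent row
    for some [i]. *)
Lemma minimal_cap_unit k (U : 'M[F]_(k, d)) (P : 'M[F]_(d, k)) (Q : 'M_d) :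
  (1 < k < d)%N -> row_free U -> (U <= Q)%MS -> row_free (row_mx P Q) ->
  (forall i, M ^+ i != 1 ->
     (d + d <= (\rank (col_mx (row_mx P Q) (row_mx P (Q *m M ^+ i)))).+1)%N) ->
  Q \in unitmx.
Proof.
case/andP=> k_gt1 lt_kd Ufree sUQ PQfree capP.
apply/negPn/negP=> /nonunitmx_ker[y y0 yQ].
have [x x0 xP] : exists2 x : 'rV_d, x != 0 & x *m P = 0.
  have : kermx P != 0.
    rewrite kermx_eq0; apply/negP=> /eqP rP.
    by have := rank_leq_col P; rewrite rP leqNgt lt_kd.
  by case/rowV0Pn=> x /sub_kermxP xP x0; exists x.
have xQ : x *m Q != 0.
  apply: contra x0 => /eqP xQ; apply/eqP; apply: (row_free_inj PQfree).
  by rewrite mul_mx_row xP xQ row_mx0 mul0mx.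
(* [Q] is singular here, so [b] comes from the independent rows of [U], which lie in the row space
   of [Q]. *)
have [b [bQ bxQ]] : exists b : 'rV_d, b *m Q != 0 /\ b *m Q != - (x *m Q).
  have [b bU] := row_free_avoid (- (x *m Q)) k_gt1 Ufree.
  by case/submxP: sUQ bU => D ->; rewrite mulmxA => bU; exists (b *m D).
have [i [Mi ker1]] := translate_ker xP xQ bQ bxQ.
have ker2 : row_mx y (- y) *m
    col_mx (row_mx P Q) (row_mx P (Q *m M ^+ i)) = 0.
  rewrite mul_row_col !mul_mx_row !mulmxA !mulNmx yQ mul0mx oppr0.
  by rewrite add_row_mx subrr addr0 row_mx0.
pose K := col_mx (row_mx (b + x) (- b)) (row_mx y (- y)).
have Kfree : row_free K.
  (* Comparing the two halves of a vanishing combination isolates [s *: x]; so [s = 0], and then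
     [t = 0]. *)
  apply: inj_row_free => v; rewrite -[v]hsubmxK mul_row_col.
  rewrite [lsubmx v]mx11_scalar [rsubmx v]mx11_scalar.
  move: (_ 0 0) (_ 0 0) => s t; rewrite !mul_scalar_mx !scale_row_mx add_row_mx.
  move/eqP; rewrite row_mx_eq0 !scalerN -opprD oppr_eq0 scalerDr addrAC.
  case/andP=> /[swap] /eqP sbty; rewrite sbty add0r scaler_eq0 (negPf x0) orbF.
  move=> /eqP s0; move/eqP: sbty; rewrite s0 scale0r add0r scaler_eq0.
  by rewrite (negPf y0) orbF => /eqP->; rewrite raddf0 row_mx0.
have /mulmx0_rank_max :
    K *m col_mx (row_mx P Q) (row_mx P (Q *m M ^+ i)) = 0.
  by rewrite mul_col_mx ker1 ker2 col_mx0.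
by rewrite (eqP Kfree); have := capP i Mi; lia.
Qed.

End TransitiveIntersections.

(** * Full flags and their two middle members *)

Lemma flag_mono (F : finFieldType) n r (t : 'I_r -> nat)
    (Y : subspaces F n r) (i j : 'I_r) :
  is_flag t Y -> (i <= j)%N -> (Y i <= Y j)%VS.
Proof.
by case=> _ _ nestY; rewrite leq_eqVlt => /predU1P[/val_inj->|/nestY[]].
Qed.

Section FullFlags.
Variables (F : finFieldType) (k : nat).
Local Notation n := (k + (k + 1))%N.
Local Notation full := (@full_type (2 * k)).
Implicit Types Y Z : subspaces F n (2 * k).

(** Trivial intersection in dimension [k] passes down to smaller members, and a sum filling the
    space in dimension [k + 1] passes up to larger ones. *)
Lemma full_flags_max_dist Y Z (a b : 'I_(2 * k)) :
  a.+1 = k -> b.+1 = (k + 1)%N -> is_flag full Y -> is_flag full Z ->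
  (forall i, dS (Y i) (Z i) = (2 * minn (full i) (n - full i))%N) <->
  \dim (Y a + Z a) = (2 * k)%N /\ \dim (Y b + Z b) = n.
Proof.
move=> aE bE flY flZ; have [_ dY _] := flY; have [_ dZ _] := flZ.
(* Indices start at 0, so [i < k] means dimension at most [k]. *)
have low (i : 'I_(2 * k)) : (i < k)%N ->
    (dS (Y i) (Z i) = (2 * minn (full i) (n - full i))%N) <->
    \dim (Y i + Z i) = (2 * full i)%N.
  by move=> ik; apply: dS_eq_max_low; rewrite ?dY ?dZ // /full_type; lia.
have high (i : 'I_(2 * k)) : (k <= i)%N ->
    (dS (Y i) (Z i) = (2 * minn (full i) (n - full i))%N) <->
    \dim (Y i + Z i) = n.
  move=> ik; apply: dS_eq_max_high; rewrite ?dY ?dZ // /full_type.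
    by lia.
  by have := ltn_ord i; lia.
split=> [maxd|[dim_a dim_b] i].
  split; last by apply/high => //; lia.
  by have /low := maxd a; rewrite /full_type aE; apply; lia.
have [lt_ik|le_ki] := ltnP i k; [apply/low|apply/high] => //.
  rewrite dimv_disjoint_sum ?dY ?dZ ?addnn -?mul2n //.
  apply/eqP; rewrite -dimv_eq0 -leqn0.
  have cap_a : (\dim (Y a :&: Z a) <= 0)%N.
    have := dimv_sum_cap (Y a) (Z a); rewrite dim_a dY dZ /full_type aE. lia.
  apply: leq_trans cap_a.
  apply/dimvS/capvS; [apply: (flag_mono flY) | apply: (flag_mono flZ)]; lia.
apply/eqP; rewrite eqn_leq; apply/andP; split.
  by have := dimvS (subvf (Y i + Z i)%VS); rewrite dimvf /dim /= mul1n.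
rewrite -{1}dim_b.
apply/dimvS/addvS; [apply: (flag_mono flY) | apply: (flag_mono flZ)]; lia.
Qed.

End FullFlags.

(** * The cyclic group generated by [g] *)

Section CyclicOrbit.
Variables (F : finFieldType) (c d : nat) (M : 'M[F]_d) (g : {'GL_(c + d)[F]}).
Hypothesis gE : glmx g = block_mx 1%:M 0 0 M.

Lemma glmx_expg i : glmx (g ^+ i)%g = block_mx 1%:M 0 0 (M ^+ i).
Proof.
elim: i => [|i IHi]; first by rewrite expg0 glmx1 expr0 [LHS]scalar_mx_block.
rewrite expgS glmxM gE IHi mulmx_block exprS !mul1mx !mulmx0 !mul0mx.
by rewrite !addr0 add0r.
Qed.

Lemma rowsp_expg m (P : 'M[F]_(m, c)) (Q : 'M_(m, d)) i :
  subspace_act (rowsp (row_mx P Q)) (g ^+ i)%g = rowsp (row_mx P (Q *m M ^+ i)).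
Proof.
rewrite subspace_act_rowsp glmx_expg mul_row_block mulmx1 !mulmx0.
by rewrite add0r addr0.
Qed.

Lemma dim_rowsp_expg m (P : 'M[F]_(m, c)) (Q : 'M_(m, d)) i j :
  \dim (subspace_act (rowsp (row_mx P Q)) (g ^+ i)%g
        + subspace_act (rowsp (row_mx P Q)) (g ^+ j)%g) =
  \rank (block_mx P (Q *m M ^+ i) 0 (Q *m (M ^+ j - M ^+ i))).
Proof.
by rewrite !rowsp_expg rowsp_add dim_rowsp rank_col_row_mx mulmxBr.
Qed.

Hypotheses (d_gt0 : (0 < d)%N) (trM : pow_transitive M).

Lemma expg_eq i j : M ^+ i = M ^+ j -> (g ^+ i = g ^+ j)%g.
Proof.
move=> eqM; apply: (@glmx_inj F (c + d)); first by rewrite addn_gt0 d_gt0 orbT.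
by rewrite !glmx_expg eqM.
Qed.

(** Letting the lower right block act on a fixed nonzero [u] is a bijection from the group onto the
    nonzero vectors. *)
Lemma order_transitive : #[g]%g = (#|F| ^ d - 1)%N.
Proof.
pose u : 'rV[F]_d := delta_mx 0 (Ordinal d_gt0).
have u0 : u != 0 := delta_row_neq0 F _.
have Munit : M \in unitmx.
  have := glmx_unit g; rewrite gE !unitmxE det_ublock unitrM => /andP[].
  by rewrite det1.
pose ev (h : {'GL_(c + d)[F]}) := u *m drsubmx (glmx h).
have evE i : ev (g ^+ i)%g = u *m M ^+ i by rewrite /ev glmx_expg block_mxKdr.
have ev_inj : {in <[g]>%g &, injective ev}.
  move=> _ _ /cycleP[i ->] /cycleP[j ->]; rewrite !evE => eq_u.
  exact/expg_eq/(pow_transitive_eq trM u0).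
rewrite orderE -(card_in_imset ev_inj).
have -> : [set ev h | h in <[g]>%g] = [set~ 0].
  apply/setP=> w; rewrite !inE; apply/imsetP/idP => [[_ /cycleP[i ->] ->]|w0].
    rewrite evE; apply: contra u0 => /eqP ui0.
    have Mi : M ^+ i \in unitmx.
      elim: i {ui0} => [|i]; first by rewrite unitmx1.
      by rewrite exprS unitmx_mul Munit.
    by rewrite -[u](mulmxK Mi) ui0 mul0mx.
  have [i <-] := trM u0 w0; exists (g ^+ i)%g; rewrite ?evE //.
  exact: mem_cycle.
by rewrite cardsC1 card_mx mul1n subn1.
Qed.

End CyclicOrbit.

(** * Optimality and size of the orbit *)

Theorem theorem5p7 (F : finFieldType) (k : nat)
  (p : {poly F}) (p_deg : (size p).-1 = (k + 1)%N)
  (g : {'GL_(k + (k + 1))[F]})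
  (U1 : 'M[F]_(k, k)) (U2 : 'M[F]_(k, k + 1))
  (v1 : 'rV[F]_k) (v2 : 'rV[F]_(k + 1))
  (X : {ffun 'I_(2 * k) -> {vspace 'rV[F]_(k + (k + 1))}}) :
  let M : 'M[F]_(k + 1) := castmx (p_deg, p_deg) (companionmx p) in
  let G : {group {'GL_(k + (k + 1))[F]}} := <[g]>%G in
  let V : 'M[F]_(k + 1, k + (k + 1)) := block_mx U1 U2 v1 v2 in
  let V2 : 'M[F]_(k + 1) := col_mx U2 v2 in
  let C := orbit (flag_action F (k + (k + 1)) (2 * k)) G X in
  (1 < k)%N ->
  primitive_poly p ->
  glmx g = block_mx 1%:M 0 0 M ->
  \rank (row_mx U1 U2) = k ->
  \rank V = (k + 1)%N ->
  is_flag (@full_type (2 * k)) X ->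
  (forall i : 'I_(2 * k), i.+1 = k -> X i = rowsp (row_mx U1 U2)) ->
  (forall i : 'I_(2 * k), i.+1 = (k + 1)%N -> X i = rowsp V) ->
  (optimum_distance_flag_code (@full_type (2 * k)) C
     <-> U1 \in unitmx /\ V2 \in unitmx) /\
  (U1 \in unitmx /\ V2 \in unitmx ->
     #|C| = #|G| /\ #|G| = (#|F| ^ (k + 1) - 1)%N).
Proof.
move=> M G V V2 C k_gt1 prim gE rankU rankV flagX XU XV.
have dM : pow_transitive M.
  by apply: companionmx_transitive => //; lia.
have d_gt0 : (0 < k + 1)%N by rewrite addn1.
pose P := col_mx U1 v1.
have VE : V = row_mx P V2 by rewrite /V block_mxEh.
have Ufree : row_free (row_mx U1 U2) by rewrite /row_free rankU.
have Vfree : row_free (row_mx P V2) by rewrite -VE /row_free rankV.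
have sU2 : (U2 <= V2)%MS by rewrite -addsmxE addsmxSl.
have lt_a : (k.-1 < 2 * k)%N by lia.
have lt_b : (k < 2 * k)%N by lia.
pose a := Ordinal lt_a; pose b := Ordinal lt_b.
have aE : a.+1 = k by rewrite /=; lia.
have bE : b.+1 = (k + 1)%N by rewrite /=; lia.
have orbP Y : Y \in C -> exists i, Y = flag_act X (g ^+ i)%g.
  by case/orbitP=> _ /cycleP[i ->] <-; exists i.
have orbI i : flag_act X (g ^+ i)%g \in C.
  by apply/orbitP; exists (g ^+ i)%g; rewrite ?mem_cycle.
have act0 : flag_act X (g ^+ 0)%g = X.
  by rewrite expg0; apply: (act1 (flag_action _ _ _)).
have flagC : is_flag_code (@full_type (2 * k)) C.
  split; first by apply/set0Pn; exists X; apply: orbit_refl.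
  by move=> _ /orbP[i ->]; apply: flag_act_is_flag.
have act_eq i j : M ^+ i = M ^+ j ->
    flag_act X (g ^+ i)%g = flag_act X (g ^+ j)%g.
  by move/(expg_eq gE d_gt0) ->.
have dim_a i j : \dim (flag_act X (g ^+ i)%g a + flag_act X (g ^+ j)%g a) =
    \rank (block_mx U1 (U2 *m M ^+ i) 0 (U2 *m (M ^+ j - M ^+ i))).
  by rewrite !ffunE (XU a aE) (dim_rowsp_expg gE).
have dim_b i j : \dim (flag_act X (g ^+ i)%g b + flag_act X (g ^+ j)%g b) =
    \rank (block_mx P (V2 *m M ^+ i) 0 (V2 *m (M ^+ j - M ^+ i))).
  by rewrite !ffunE (XV b bE) VE (dim_rowsp_expg gE).
(* An element fixing the flag fixes its member of dimension [k], so [row_mx_stab_eq0] applies. *)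
have free_act i : row_free U2 -> U1 != 0 -> M ^+ i != 1 ->
    flag_act X (g ^+ i)%g != X.
  move=> U2free U1_neq0 Mi; apply: contra U1_neq0 => /eqP/ffunP/(_ a).
  rewrite ffunE (XU a aE) (rowsp_expg gE) => eq_a; apply/eqP.
  apply: (row_mx_stab_eq0 (A := M ^+ i) U2free).
    by have := pow_sub_unit dM (i := i) (j := 0); apply.
  by rewrite -rowspS eq_a.
have cardG : #|G| = (#|F| ^ (k + 1) - 1)%N by apply: (order_transitive gE).
have optP := optimum_distanceP _ flagC.
have {}optP : optimum_distance_flag_code (@full_type (2 * k)) C <->
    (exists i, flag_act X (g ^+ i)%g != X) /\
    (forall i j, flag_act X (g ^+ i)%g != flag_act X (g ^+ j)%g ->
       \rank (block_mx U1 (U2 *m M ^+ i) 0 (U2 *m (M ^+ j - M ^+ i)))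
         = (2 * k)%N /\
       \rank (block_mx P (V2 *m M ^+ i) 0 (V2 *m (M ^+ j - M ^+ i)))
         = (k + (k + 1))%N).
  have pairP i j := full_flags_max_dist aE bE
    (flag_act_is_flag (g ^+ i)%g flagX)
    (flag_act_is_flag (g ^+ j)%g flagX).
  rewrite optP; last first.
    (* The member of dimension [k] alone makes the maximal distance positive. *)
    by rewrite (bigD1 a) //= /full_type aE; lia.
  split=> [[[Y [Z [YC ZC YZ]]] maxd] | [[i iX] maxd]].
    split.
      have [YX|] := eqVneq Y X.
        by have [i ZE] := orbP _ ZC; exists i; rewrite -ZE -YX eq_sym.
      by have [i ->] := orbP _ YC; exists i.
    move=> i j ij; rewrite -dim_a -dim_b; apply/pairP => l.
    by apply: maxd; rewrite ?orbI.
  split; first by exists (flag_act X (g ^+ i)%g), X; rewrite orbI orbit_refl.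
  move=> Y Z l /orbP[i1 ->] /orbP[j1 ->] /maxd; rewrite -dim_a -dim_b.
  by move/pairP.
have unit_free : U1 \in unitmx -> V2 \in unitmx -> row_free U2 /\ U1 != 0.
  move=> U1u V2u; split.
    apply: inj_row_free => v vU2.
    have : row_mx v 0 *m V2 = 0 by rewrite mul_row_col vU2 mul0mx addr0.
    move/(congr1 (mulmx^~ (invmx V2))); rewrite mulmxK // mul0mx.
    by move/eqP; rewrite row_mx_eq0 => /andP[/eqP].
  by rewrite -mxrank_eq0 mxrank_unit //; lia.
split; last first.
  case=> U1u V2u; have [U2free U10] := unit_free U1u V2u; split=> //.
  rewrite card_orbit_in ?subsetT //.
  suff -> : 'C_G[X | flag_action F (k + (k + 1)) (2 * k)]%g = 1%g.
    by rewrite indexg1.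
  apply/trivgP/subsetP=> h; rewrite inE => /andP[/cycleP[i ->]].
  case/setIP=> _; rewrite inE sub1set inE => fixX.
  have [Mi|Mi] := eqVneq (M ^+ i) (M ^+ 0).
    by rewrite (expg_eq gE d_gt0 Mi) expg0 group1.
  by have := free_act i U2free U10 Mi; rewrite [flag_act _ _](eqP fixX) eqxx.
rewrite optP; split=> [[[i0 i0X] maxd]|[U1u V2u]]; last first.
  have [U2free U10] := unit_free U1u V2u; split.
    (* If [M] were 1, then [g] would be trivial, while its order exceeds 1 because q^(k+1) > q >=
       2. *)
    exists 1%N; apply: free_act => //; apply/eqP=> M1.
    have g1 : (g ^+ 1 = g ^+ 0)%g by apply: (expg_eq gE d_gt0); rewrite M1.
    have q_gt1 := card_finNzRing_gt1 F.
    have : (#|F| ^ 1 < #|F| ^ (k + 1))%N by rewrite ltn_exp2l //; lia.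
    have := cardG; rewrite /= -orderE -[g]expg1 g1 expg0 order1 expn1.
    move=> card1 /(leq_ltn_trans q_gt1).
    by rewrite -(addn1 1) -ltn_subRL -card1.
  move=> i j; have [/act_eq->|Mij _] := eqVneq (M ^+ j) (M ^+ i).
    by rewrite eqxx.
  have /= Du := pow_sub_unit dM Mij.
  (* [U1] clears the first matrix and [V2 *m (M ^+ j - M ^+ i)] the second, leaving the ranks of
     [U2] and [P], both [k]. *)
  rewrite rank_ublock_unitl // rank_ublock_unitr ?unitmx_mul ?V2u //.
  rewrite mxrankMfree ?row_free_unit // (eqP U2free); split; first by lia.
  suff -> : \rank P = k by [].
  apply/eqP; rewrite eqn_leq rank_leq_col -{1}(mxrank_unit U1u) mxrankS //.
  by rewrite -addsmxE addsmxSl.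
have rank_at i : flag_act X (g ^+ i)%g != X ->
   \rank (block_mx U1 U2 0 (U2 *m (M ^+ i - 1))) = (2 * k)%N /\
   \rank (block_mx P V2 0 (V2 *m (M ^+ i - 1))) = (k + (k + 1))%N.
  by rewrite eq_sym -{1}act0 => /maxd; rewrite expr0 !mulmx1.
have [ra rb] := rank_at i0 i0X.
have U2free : row_free U2.
  (* The upper rows contribute rank [k], so the lower ones must supply another [k], which is at most
     the rank of [U2]. *)
  rewrite /row_free eqn_leq rank_leq_row -(leq_add2l k).
  have := (mxrank_adds_leqif (row_mx U1 U2) (row_mx 0 (U2 *m (M ^+ i0 - 1)))).1.
  rewrite addsmxE -block_mxEv ra rankU rank_row_0mx mul2n -addnn.
  by move/leq_trans; apply; rewrite leq_add2l mxrankM_maxl.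
have U10 : U1 != 0.
  (* With [U1 = 0], rank [2 * k] would have to fit into [k + 1] columns. *)
  apply/eqP=> U10; move: ra; rewrite U10 block_mxEh col_mx0 rank_row_0mx => ra.
  by have := rank_leq_col (col_mx U2 (U2 *m (M ^+ i0 - 1))); rewrite ra; lia.
(* The stabilizer being trivial, the rank conditions extend from [i0] to every [i] with [M ^+ i] not
   1. *)
have rank_pow i (Mi : M ^+ i != 1) := rank_at i (free_act i U2free U10 Mi).
split.
  apply: (trivial_cap_unit dM k_gt1 Ufree U2free) => i Mi.
  rewrite /row_free rank_col_row_mx -{3}[U2]mulmx1 -mulmxBr.
  by rewrite (rank_pow i Mi).1 mul2n addnn.
(* The rank [k + (k + 1)] is one less than the [2 * (k + 1)] stacked rows, just what is required. *)
apply: (minimal_cap_unit dM _ U2free sU2 Vfree) => [|i Mi].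
  by rewrite k_gt1 addn1 /=.
rewrite rank_col_row_mx -{3}[V2]mulmx1 -mulmxBr (rank_pow i Mi).2; lia.
Qed.
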